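(* Let $G$ be an infinite, locally finite, connected simple graph with a fixed vertex $a$, and let $\psi:G\to\mathbb{C}$. If $M_\psi$ is a bounded multiplication operator on $\hat{\mathcal{L}}$ (or equivalently, on $\hat{\mathcal{L}}_0$), then $$\max\{\|\psi\|_{\hat{\mathcal{L}}}^{a},\ \|\psi\|_\infty\}\le \|M_\psi\|\le \|\psi\|_\infty+\sigma_\psi ,$$ where $\|M_\psi\|$ is the operator norm of $M_\psi$ acting on $\hat{\mathcal{L}}$ (respectively, on $\hat{\mathcal{L}}_0$).
   Context: A graph is always connected, undirected, simple, with infinitely many vertices, each of finite degree; $G$ also denotes its vertex set, $v\sim w$ means $v$ and $w$ are adjacent, $N_v=\{w\in G: w\sim v\}$, and $d$ is the graph distance. $\sup_{v\sim w}$ is the supremum over all (ordered) pairs of adjacent vertices. The Lipschitz space is $\hat{\mathcal{L}}=\{f:G\to\mathbb{C} : \sup_{v\sim w}|f(v)-f(w)|<\infty\}$ with norm $\|f\|_{\hat{\mathcal{L}}}^{a}:=|f(a)|+\sup_{v\sim w}|f(v)-f(w)|$. The little Lipschitz space $\hat{\mathcal{L}}_0$, with the same norm, is the set of $f\in\hat{\mathcal{L}}$ with $\lim_{d(a,v)\to\infty}\max_{w\in N_v}|f(v)-f(w)|=0$ (for every $\epsilon>0$ there is $N\in\mathbb{N}$ with $\max_{w\in N_v}|f(v)-f(w)|<\epsilon$ whenever $d(a,v)>N$). $M_\psi f:=\psi f$; ''$M_\psi$ is bounded on $X$'' means $\psi f\in X$ for every $f\in X$ and $M_\psi:X\to X$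 is a bounded linear operator. Boundedness of $M_\psi$ on $\hat{\mathcal{L}}$ is equivalent to boundedness on $\hat{\mathcal{L}}_0$. Notation: $\|\psi\|_\infty=\sup_{v\in G}|\psi(v)|$ and $\sigma_\psi=\sup_{v\sim w}d(a,v)|\psi(v)-\psi(w)|$. *)

(* Defs.v *)
From HB Require Import structures.
From mathcomp Require Import all_boot all_order all_algebra.
From mathcomp Require Import all_classical all_reals all_analysis.
From mathcomp Require Import finmap complex.
Set Implicit Arguments.
Unset Strict Implicit.
Unset Printing Implicit Defensive.
Import Order.TTheory GRing.Theory Num.Theory.
Local Open Scope classical_set_scope.
Local Open Scope ring_scope.

Record graph := Graph {
  vertex :> choiceType;
  adj : rel vertex;
  adj_sym : symmetric adj;
  adj_irr : irreflexive adj;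
  graph_infinite : infinite_set [set: vertex];
  graph_locally_finite : forall v, finite_set [set w | adj v w];
  graph_connected : forall v w, exists p : seq vertex,
    path adj v p /\ last v p = w }.

Definition neighbours (G : graph) (v : G) : set G := [set w | adj w v].

Definition has_walk (G : graph) (v w : G) : pred nat := fun n =>
  `[< exists p : seq G, [/\ path (@adj G) v p, last v p = w & size p = n] >].

Lemma has_walk_ex (G : graph) (v w : G) : exists n, has_walk v w n.
Proof.
by have [p [pp lp]] := graph_connected v w; exists (size p); apply/asboolP; exists p.
Qed.

Definition gdist (G : graph) (v w : G) : nat := ex_minn (has_walk_ex v w).

(* The modulus of R[i] as an element of R; the mathcomp norm `|z| of z : R[i]
   is an element of R[i]. *)
Definition cmod (R : realType) (z : R[i]) : R := ComplexField.Normc.normc z.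

(* Suprema are taken in \bar R, so that they are +oo when unbounded. *)
Section Spaces.
Context (R : realType) (G : graph) (a : G).
Implicit Types (f g psi : G -> R[i]) (X : set (G -> R[i])).

Definition lip_sup f : \bar R :=
  ereal_sup [set (cmod (f e.1 - f e.2))%:E | e in [set e : G * G | adj e.1 e.2]].

Definition Lip : set (G -> R[i]) := [set f | (lip_sup f < +oo)%E].

Definition lip_norm f : \bar R := ((cmod (f a))%:E + lip_sup f)%E.

(* The neighbourhood of v is finite and nonempty, and the values are
   nonnegative: the initial value 0 does not affect the maximum. *)
Definition local_var f (v : G) : R :=
  \big[Order.max/0]_(w <- fset_set (neighbours v)) cmod (f v - f w).

Definition Lip0 : set (G -> R[i]) :=
  [set f | Lip f /\ forall eps : R, 0 < eps ->
     exists N : nat, forall v : G, (N < gdist a v)%N -> local_var f v < eps].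

Definition bounded_op X (T : (G -> R[i]) -> (G -> R[i])) : Prop :=
  [/\ forall f, X f -> X (T f),
      forall (c : R[i]) f g, X f -> X g ->
        T (fun v => c * f v + g v) = (fun v => c * T f v + T g v)
    & exists C : R, forall f, X f -> (lip_norm (T f) <= C%:E * lip_norm f)%E].

Definition op_norm X (T : (G -> R[i]) -> (G -> R[i])) : \bar R :=
  ereal_sup [set lip_norm (T f) | f in [set f | X f /\ (lip_norm f <= 1)%E]].

Definition mult_op psi : (G -> R[i]) -> (G -> R[i]) := fun f v => psi v * f v.

Definition sup_norm psi : \bar R := ereal_sup [set (cmod (psi v))%:E | v in [set: G]].

Definition sigma psi : \bar R :=
  ereal_sup [set ((gdist a e.1)%:R * cmod (psi e.1 - psi e.2))%:E
            | e in [set e : G * G | adj e.1 e.2]].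

End Spaces.
Arguments Lip {R G}.
Arguments Lip0 {R G} a.

(* Main.v *)
Require Import Defs.
From mathcomp Require Import all_boot all_order all_algebra.
From mathcomp Require Import all_classical all_reals all_analysis.
From mathcomp Require Import complex.
From mathcomp Require Import ring lra.
Set Implicit Arguments.
Unset Strict Implicit.
Unset Printing Implicit Defensive.
Import Order.TTheory GRing.Theory Num.Theory.
Local Open Scope classical_set_scope.
Local Open Scope ring_scope.

(** The lower bound comes from two families of test functions that lie in the
    little space, hence in both spaces.  The constant function 1 has norm 1 and
    image psi, so the operator norm is at least the norm of psi; in particular
    it is at least |psi(a)|.  For v different from a, the indicator of v
    vanishes at a and has norm 1, because v has a neighbour; it is an
    eigenvector of the multiplication operator with eigenvalue psi(v), so the
    operator norm is at least |psi(v)| ([mult_op_indicator],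
    [sup_norm_le_op_norm]).

    The upper bound comes from the product rule
      psi(v) f(v) - psi(w) f(w)
        = psi(w) (f(v) - f(w)) + f(v) (psi(v) - psi(w)).
    If p = |f(a)| and s is the Lipschitz constant of f, summing the increments
    of f along a shortest path from a to v gives |f(v)| <= p + d(a,v) s
    ([cmod_le_gdist]).  With K = sup |psi| and S = sigma, the
    differences of psi along edges are at most S ([edge_diff_le_sigma]), so
    the product rule bounds the norm of psi f by
      K p + (K s + p S + s S) = (K + S) (p + s),
    and p + s <= 1 on the unit ball.

    The estimate of the norm of psi f concerns a single function, so the upper
    bound holds on any set of functions; the lower bound passes from the little
    space to the large one because the operator norm is monotone in the space
    ([op_norm_mono]). *)

(** * The modulus *)

Section Modulus.
Context (R : realType).
Implicit Types x y : R[i].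

Lemma cmodM x y : cmod (x * y) = cmod x * cmod y.
Proof. exact: ComplexField.Normc.normcM. Qed.

Lemma cmodD x y : cmod (x + y) <= cmod x + cmod y.
Proof. exact: (@le_normcD R x y). Qed.

Lemma cmodN x : cmod (- x) = cmod x.
Proof. exact: (@normcN R x). Qed.

Lemma cmodC x y : cmod (x - y) = cmod (y - x).
Proof. by rewrite -opprB cmodN. Qed.

Lemma cmod0 : cmod (0 : R[i]) = 0.
Proof. exact: ComplexField.Normc.normc0. Qed.

Lemma cmod1 : cmod (1 : R[i]) = 1.
Proof. exact: ComplexField.Normc.normc1. Qed.

Lemma cmod_ge0 x : 0 <= cmod x.
Proof. by case: x => u v; exact: sqrtr_ge0. Qed.

End Modulus.

(** * Graph distance *)

Section Graphs.
Context (G : graph).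
Implicit Types u v w : G.

Lemma gdist_path v w :
  exists p : seq G, [/\ path (@adj G) v p, last v p = w & size p = gdist v w].
Proof. by rewrite /gdist; case: ex_minnP => n /asboolP. Qed.

Lemma gdist_le v w (p : seq G) :
  path (@adj G) v p -> last v p = w -> (gdist v w <= size p)%N.
Proof.
move=> pp lp; rewrite /gdist; case: ex_minnP => n _; apply.
by apply/asboolP; exists p.
Qed.

Lemma gdist_gt0 v w : v != w -> (0 < gdist v w)%N.
Proof.
move=> vw; have [p [_ lp <-]] := gdist_path v w.
by case: p lp vw => //= <-; rewrite eqxx.
Qed.

Lemma gdist_adj u v w : adj v w -> (gdist u w <= (gdist u v).+1)%N.
Proof.
move=> vw; have [p [pp lp <-]] := gdist_path u v.
rewrite -(size_rcons p w); apply: gdist_le; last by rewrite last_rcons.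
by rewrite rcons_path pp lp.
Qed.

Lemma neighbour_neq v w : v != w -> exists u, adj v u.
Proof.
move=> vw; have [p [pp lp]] := graph_connected v w.
case: p pp lp => [_ /= lp|u p /= /andP[vu _] _]; last by exists u.
by rewrite lp eqxx in vw.
Qed.

Lemma exists_neighbour v : exists u, adj v u.
Proof.
have := @infinite_setN0 G ([set: G] `\` [set v]).
case=> [|w [_ /= /eqP wv]]; last by apply: (@neighbour_neq v w); rewrite eq_sym.
by apply: infinite_setD; [exact: graph_infinite|exact: finite_set1].
Qed.

Lemma finite_neighbours v : finite_set (neighbours v).
Proof.
rewrite (_ : neighbours v = [set w | adj v w]); first exact: graph_locally_finite.
by apply/seteqP; split=> w /=; rewrite /neighbours /= adj_sym.
Qed.

End Graphs.

Section Multiplication.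
Context (R : realType) (G : graph) (a : G).
Implicit Types (f psi : G -> R[i]) (v w : G).

(** * The Lipschitz seminorm *)

Lemma le_lip_sup f v w : adj v w -> ((cmod (f v - f w))%:E <= lip_sup f)%E.
Proof. by move=> vw; apply: ereal_sup_ubound; exists (v, w). Qed.

Lemma lip_sup_le f (C : \bar R) :
  (forall v w, adj v w -> ((cmod (f v - f w))%:E <= C)%E) -> (lip_sup f <= C)%E.
Proof. by move=> H; apply: ge_ereal_sup => _ [[v w] /= vw <-]; exact: H. Qed.

(** The supremum runs over a nonempty set of edges, so it is not -oo. *)
Lemma lip_sup_ge0 f : (0 <= lip_sup f)%E.
Proof.
have [w aw] := exists_neighbour a.
by apply: le_trans (le_lip_sup f aw); rewrite lee_fin cmod_ge0.
Qed.

Lemma lip_norm_real f (M : R) : (lip_norm a f <= M%:E)%E ->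
  exists2 s : R, lip_sup f = s%:E & cmod (f a) + s <= M.
Proof.
rewrite /lip_norm; have := lip_sup_ge0 f.
by case: (lip_sup f) => [s| |] //= _; rewrite -EFinD lee_fin => h; exists s.
Qed.

Lemma cmod_le_gdist f (s : R) v :
  (forall u w, adj u w -> cmod (f u - f w) <= s) ->
  cmod (f v) <= cmod (f a) + (gdist a v)%:R * s.
Proof.
move=> lipf; have [p [pp <- <-]] := gdist_path a v.
elim: p (a) pp => [|w p IHp] u /=; first by rewrite mul0r addr0.
case/andP=> uw /IHp pw; apply: le_trans pw _.
have := cmodD (f u) (f w - f u); rewrite [f u + _]addrC subrK [cmod (f w - _)]cmodC.
by have := lipf _ _ uw; rewrite -natr1 mulrDl mul1r; lra.
Qed.

Lemma subset_Lip0_Lip : Lip0 a `<=` (Lip : set (G -> R[i])).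
Proof. by move=> f []. Qed.

Lemma le_op_norm (X : set (G -> R[i])) T f :
  X f -> (lip_norm a f <= 1)%E -> (lip_norm a (T f) <= op_norm a X T)%E.
Proof. by move=> Xf f1; apply: ereal_sup_ubound; exists f. Qed.

Lemma op_norm_mono (X Y : set (G -> R[i])) T :
  X `<=` Y -> (op_norm a X T <= op_norm a Y T)%E.
Proof.
move=> XY; apply: ge_ereal_sup => _ [f [Xf f1] <-].
by apply: le_op_norm => //; exact: XY.
Qed.

(** * Upper bound *)

Lemma le_sup_norm psi v : ((cmod (psi v))%:E <= sup_norm psi)%E.
Proof. by apply: ereal_sup_ubound; exists v. Qed.

Lemma le_sigma psi v w : adj v w ->
  (((gdist a v)%:R * cmod (psi v - psi w))%:E <= sigma a psi)%E.
Proof. by move=> vw; apply: ereal_sup_ubound; exists (v, w). Qed.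

(** Since sigma ranges over ordered pairs, the edge can be oriented so that its
    first end is not a, and then the weight d(a,v) is at least 1. *)
Lemma edge_diff_le_sigma psi v w : adj v w ->
  ((cmod (psi v - psi w))%:E <= sigma a psi)%E.
Proof.
wlog va : v w / a != v => [hwlog vw|vw].
  have [av|] := eqVneq a v; last by move/hwlog; exact.
  rewrite cmodC; apply: hwlog; last by rewrite adj_sym.
  by apply: contraTneq vw => <-; rewrite av adj_irr.
apply: le_trans (le_sigma psi vw); rewrite lee_fin ler_peMl ?cmod_ge0//.
by rewrite ler1n gdist_gt0.
Qed.

Lemma lip_norm_mult_op_le psi f : (lip_norm a f <= 1)%E ->
  (lip_norm a (mult_op psi f) <= sup_norm psi + sigma a psi)%E.
Proof.
move=> /lip_norm_real[s fs ps1].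
have psiK := le_sup_norm psi; have psiS := @edge_diff_le_sigma psi.
have psidS := @le_sigma psi.
have K0 : (0 <= sup_norm psi)%E.
  by apply: le_trans (psiK a); rewrite lee_fin cmod_ge0.
have S0 : (0 <= sigma a psi)%E.
  have [w aw] := exists_neighbour a.
  by apply: le_trans (psiS _ _ aw); rewrite lee_fin cmod_ge0.
move: (sup_norm psi) (sigma a psi) K0 S0 psiK psiS psidS.
move=> [K| |] [S| |] //= K0 S0 psiK psiS psidS; rewrite ?leey//.
rewrite lee_fin in K0; rewrite lee_fin in S0.
have s0 : 0 <= s by rewrite -lee_fin -fs lip_sup_ge0.
have lipf v w : adj v w -> cmod (f v - f w) <= s.
  by move=> vw; rewrite -lee_fin -fs le_lip_sup.
have edge v w : adj v w -> cmod (psi v * f v - psi w * f w) <=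
    K * s + cmod (f a) * S + s * S.
  move=> vw; have -> : psi v * f v - psi w * f w =
      psi w * (f v - f w) + f v * (psi v - psi w).
    by ring.
  apply: le_trans (cmodD _ _) _; rewrite !cmodM -addrA; apply: lerD.
    by apply: ler_pM; rewrite ?cmod_ge0 ?lipf// -lee_fin.
  have d1 := psiS _ _ vw; have d2 := psidS _ _ vw.
  rewrite !lee_fin in d1 d2.
  have fv := ler_wpM2r (cmod_ge0 (psi v - psi w)) (cmod_le_gdist v lipf).
  apply: le_trans fv _; rewrite mulrDl; apply: lerD.
    by rewrite ler_wpM2l ?cmod_ge0.
  by rewrite mulrAC mulrC ler_wpM2l.
apply: (@le_trans _ _
  ((K * cmod (f a))%:E + (K * s + cmod (f a) * S + s * S)%:E)%E).
  apply: leeD; last by apply: lip_sup_le => v w vw; rewrite lee_fin; exact: edge.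
  by rewrite lee_fin /mult_op cmodM ler_wpM2r ?cmod_ge0// -lee_fin.
rewrite -!EFinD lee_fin.
have -> : K * cmod (f a) + (K * s + cmod (f a) * S + s * S) =
    (K + S) * (cmod (f a) + s) by lra.
by rewrite ler_piMr// addr_ge0.
Qed.

Lemma op_norm_mult_op_le (X : set (G -> R[i])) psi :
  (op_norm a X (mult_op psi) <= sup_norm psi + sigma a psi)%E.
Proof. by apply: ge_ereal_sup => _ [f [_ f1] <-]; exact: lip_norm_mult_op_le. Qed.

(** * Lower bound *)

(** Each difference in [local_var] is at an edge, so a function that is constant
    near every far vertex belongs to the little space. *)
Lemma Lip0_far_constant f (N : nat) : Lip f ->
  (forall v w, adj v w -> (N < gdist a v)%N -> f v = f w) -> Lip0 a f.
Proof.
move=> Lf fN; split=> // eps eps0; exists N => v Nv; rewrite /local_var.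
rewrite big_seq_cond; apply: bigmax_lt => // w /andP[+ _].
rewrite in_fset_set; last exact: finite_neighbours.
rewrite inE /neighbours /= => wv.
by rewrite (fN v w) ?subrr ?cmod0// adj_sym.
Qed.

Lemma lip_norm_cst1 : lip_norm a (fun=> 1 : R[i]) = 1%E.
Proof.
rewrite /lip_norm cmod1 (_ : lip_sup _ = 0%E) ?adde0//.
apply/eqP; rewrite eq_le lip_sup_ge0 andbT.
by apply: lip_sup_le => v w _; rewrite subrr cmod0.
Qed.

Lemma Lip0_cst1 : Lip0 a (fun=> 1 : R[i]).
Proof.
apply: (@Lip0_far_constant _ 0) => //.
rewrite /Lip /=; apply: (@le_lt_trans _ _ 0%E); last exact: ltry.
by apply: lip_sup_le => v w _; rewrite subrr cmod0.
Qed.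

Lemma lip_norm_le_op_norm psi :
  (lip_norm a psi <= op_norm a (Lip0 a) (mult_op psi))%E.
Proof.
have -> : lip_norm a psi = lip_norm a (mult_op psi (fun=> 1)).
  by congr lip_norm; apply/funext => v; rewrite /mult_op mulr1.
by apply: le_op_norm; [exact: Lip0_cst1|rewrite lip_norm_cst1].
Qed.

Definition indicator v : G -> R[i] := fun u => (u == v)%:R.

Lemma mult_op_indicator psi v :
  mult_op psi (indicator v) = (fun u => psi v * indicator v u).
Proof.
by apply/funext => u; rewrite /mult_op /indicator; case: eqVneq => [->|_];
  rewrite ?mulr0.
Qed.

Lemma lip_sup_indicator_le1 v : (lip_sup (indicator v) <= 1)%E.
Proof.
apply: lip_sup_le => u w _; rewrite lee_fin /indicator.
by case: (u == v); case: (w == v);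
  rewrite ?subrr ?subr0 ?sub0r ?cmodN ?cmod0 ?cmod1.
Qed.

Lemma Lip0_indicator v : Lip0 a (indicator v).
Proof.
apply: (@Lip0_far_constant _ (gdist a v).+1).
  exact: le_lt_trans (lip_sup_indicator_le1 v) (ltry _).
move=> u w uw far; rewrite /indicator.
have /negPf -> : u != v by apply: contraTneq far => ->; rewrite -leqNgt.
have /negPf -> // : w != v.
(* A neighbour of v is at distance at most d(a,v) + 1. *)
by apply: contraTneq far => <-; rewrite -leqNgt gdist_adj// adj_sym.
Qed.

(** The eigenvector argument needs an indicator of norm at most 1, hence v
    different from a, where the indicator has norm 2; at a the value |psi(a)|
    is already part of the norm of psi. *)
Lemma sup_norm_le_op_norm psi :
  (sup_norm psi <= op_norm a (Lip0 a) (mult_op psi))%E.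
Proof.
apply: ge_ereal_sup => _ [v _ <-]; have [->|va] := eqVneq v a.
  by apply: le_trans (lip_norm_le_op_norm psi); rewrite leeDl// lip_sup_ge0.
have ind1 : (lip_norm a (indicator v) <= 1)%E.
  by rewrite /lip_norm {1}/indicator eq_sym (negPf va) cmod0 add0e
    lip_sup_indicator_le1.
apply: le_trans (le_op_norm (mult_op psi) (Lip0_indicator v) ind1).
rewrite mult_op_indicator; have [w vw] := exists_neighbour v.
have wv : (w == v) = false by apply: contraTF vw => /eqP ->; rewrite adj_irr.
apply: le_trans (leeDr _ _); last by rewrite lee_fin cmod_ge0.
apply: le_trans (le_lip_sup _ vw).
by rewrite /indicator eqxx wv mulr1 mulr0 subr0.
Qed.

End Multiplication.

Theorem theorem5p4 (R : realType) (G : graph) (a : G) (psi : G -> R[i]) :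
  bounded_op a Lip (mult_op psi) \/ bounded_op a (Lip0 a) (mult_op psi) ->
  (Order.max (lip_norm a psi) (sup_norm psi) <= op_norm a Lip (mult_op psi) /\
   op_norm a Lip (mult_op psi) <= sup_norm psi + sigma a psi)%E /\
  (Order.max (lip_norm a psi) (sup_norm psi) <= op_norm a (Lip0 a) (mult_op psi) /\
   op_norm a (Lip0 a) (mult_op psi) <= sup_norm psi + sigma a psi)%E.
Proof.
move=> _.
have lower : (Order.max (lip_norm a psi) (sup_norm psi) <=
    op_norm a (Lip0 a) (mult_op psi))%E.
  by rewrite ge_max lip_norm_le_op_norm sup_norm_le_op_norm.
split; split=> //; try exact: op_norm_mult_op_le.
exact: le_trans lower (op_norm_mono _ _ (@subset_Lip0_Lip R G a)).
Qed.
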